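(* Let $F_0,Q_0\in\mathbb{R}^{n\times n}$ with $\det F_0>0$. For each of the viscous stress tensors $\mathcal{Z}$ below, the linear map $M=D_Q\mathcal{Z}(F_0,Q_0)$ satisfies, for every bounded open set $U\subset\mathbb{R}^n$, the Korn-type inequality $$\|\nabla\zeta\|^2_{L_2(U)}\le\gamma\int_U(M\nabla\zeta):\nabla\zeta\qquad\forall\zeta\in W^1_2(U,\mathbb{R}^n)\text{ with }\zeta_{|\partial U}=0,$$ with the indicated constant $\gamma$: (i) $\mathcal{Z}=\mathcal{Z}_0''$ with $\gamma=|F_0^{-1,T}|^2$; (ii) $\mathcal{Z}=\mathcal{Z}_0'$ with $\gamma=|F_0|^2(\det F_0)^{-1}$; (iii) $\mathcal{Z}=\mathcal{Z}_0$ with $\gamma=2|F_0|^2$. If additionally $\det\mathrm{sym}(Q_0F_0^{-1})\ne0$, then also: (iv) $\mathcal{Z}=\mathcal{Z}_1$ with $\gamma=2|F_0|^2\,\big|(\mathrm{sym}(Q_0F_0^{-1}))^{-1}\big|^2$; (v) $\mathcal{Z}=\mathcal{Z}_2$ with $\gamma=2|F_0|^2\,\big|(\mathrm{sym}(Q_0F_0^{-1}))^{-1}\big|^4$.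
   Context: Notation: $A:B=\mathrm{tr}(A^TB)$ for $A,B\in\mathbb{R}^{n\times n}$, $|A|=(\mathrm{tr}(A^TA))^{1/2}$, $\mathrm{sym}\,A=\frac12(A+A^T)$, and $F^{-1,T}=(F^{-1})^T$. For $F,Q\in\mathbb{R}^{n\times n}$ with $\det F>0$ define $$\mathcal{Z}_m(F,Q)=[\mathrm{sym}(QF^{-1})]^{2m+1}F^{-1,T}\quad(m=0,1,2),$$ $$\mathcal{Z}_0'(F,Q)=2(\det F)\,\mathrm{sym}(QF^{-1})F^{-1,T},\qquad \mathcal{Z}_0''(F,Q)=2F\,\mathrm{sym}(F^TQ).$$ $D_Q\mathcal{Z}(F_0,Q_0):\mathbb{R}^{n\times n}\to\mathbb{R}^{n\times n}$ is the derivative of $\mathcal{Z}$ with respect to its second argument at $(F_0,Q_0)$. The condition $\zeta_{|\partial U}=0$ is understood in the trace sense, i.e. $\zeta$ lies in the closure of $C_c^\infty(U,\mathbb{R}^n)$ in $W^1_2(U,\mathbb{R}^n)$. *)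

(* Defs.v *)
From HB Require Import structures.
From mathcomp Require Import all_boot all_order all_algebra.
From mathcomp Require Import all_classical all_reals all_analysis.

Set Implicit Arguments.
Unset Strict Implicit.
Unset Printing Implicit Defensive.

Import Order.TTheory GRing.Theory Num.Theory.
Import numFieldNormedType.Exports.

Local Open Scope classical_set_scope.
Local Open Scope ring_scope.

(* Points of R^n are row vectors 'rV[R]_n. *)

Section matrix_measurable.
Context (R : realType) (m n : nat).

(* Product sigma-algebra of the Borel sets of R; it is the Borel sigma-algebra
   of 'M[R]_(m, n), the topology of which is the product topology. *)
Definition matrix_cylinders : set (set 'M[R]_(m, n)) :=
  [set (fun M : 'M[R]_(m, n) => M ij.1 ij.2) @^-1` B
    | ij in [set: 'I_m * 'I_n] & B in (measurable : set (set R))].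

Let measurable0 : <<s matrix_cylinders >> set0.
Proof. exact: sigma_algebra0. Qed.

Let measurableC A : <<s matrix_cylinders >> A -> <<s matrix_cylinders >> (~` A).
Proof. exact: sigma_algebraC. Qed.

Let measurable_bigcup (F : (set 'M[R]_(m, n))^nat) :
  (forall i, <<s matrix_cylinders >> (F i)) ->
  <<s matrix_cylinders >> (\bigcup_i F i).
Proof. exact: sigma_algebra_bigcup. Qed.

HB.instance Definition _ :=
  @isMeasurable.Build (sigma_display matrix_cylinders) 'M[R]_(m, n)
    <<s matrix_cylinders >> measurable0 measurableC measurable_bigcup.

End matrix_measurable.

Lemma measurable_coord (R : realType) m n (i : 'I_m) (j : 'I_n) :
  measurable_fun [set: 'M[R]_(m, n)] (fun M : 'M[R]_(m, n) => M i j : R).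
Proof.
move=> _ B mB; rewrite setTI; apply: sub_sigma_algebra.
by exists (i, j) => //; exists B.
Qed.

Lemma measurable_matrixP (R : realType) m n d (T : measurableType d)
    (f : T -> 'M[R]_(m, n)) :
  (forall i j, measurable_fun [set: T] (fun t => f t i j : R)) ->
  measurable_fun [set: T] f.
Proof.
move=> mf; apply: (measurability (@matrix_cylinders R m n)) => //.
by move=> A [_ [[i j] _ [B mB <-]] <-]; exact: mf.
Qed.

Section lebesgue_rV.
Context (R : realType).

Definition cons_rV n (p : R * 'rV[R]_n) : 'rV[R]_n.+1 :=
  row_mx (const_mx p.1 : 'rV[R]_1) p.2.

Definition uncons_rV n (v : 'rV[R]_n.+1) : R * 'rV[R]_n :=
  (v ord0 ord0, @rsubmx _ 1 1 n v).

Lemma cons_rVK n : cancel (@cons_rV n) (@uncons_rV n).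
Proof.
move=> [x v]; congr pair; last exact: row_mxKr.
rewrite /cons_rV /= (_ : @ord0 n = lshift n (@ord0 0)); last exact: val_inj.
by rewrite [LHS]row_mxEl mxE.
Qed.

Lemma measurable_cons_rV n : measurable_fun setT (@cons_rV n).
Proof.
apply: measurable_matrixP => i j.
have -> : (fun p => @cons_rV n p i j) =
    (fun p => if fintype.split (j : 'I_(1 + n)) is inr k then p.2 ord0 k else p.1).
  apply/funext => p /=; rewrite /cons_rV mxE ord1.
  by case: fintype.splitP => k _ //; rewrite mxE.
case: fintype.split => k; first exact: measurable_fst.
exact: (measurableT_comp (measurable_coord ord0 k) measurable_snd).
Qed.

Lemma measurable_uncons_rV n : measurable_fun setT (@uncons_rV n).
Proof.
apply: measurable_fun_pair; first exact: measurable_coord.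
apply: measurable_matrixP => i j.
under eq_fun do rewrite mxE.
exact: measurable_coord.
Qed.

Section cons_measure.
Variables (n : nat) (mu : {sigma_finite_measure set 'rV[R]_n -> \bar R}).
Local Open Scope ereal_scope.

Definition cons_measure : set 'rV[R]_n.+1 -> \bar R :=
  pushforward (lebesgue_measure \x mu) (@cons_rV n).

Let cons_measure0 : cons_measure set0 = 0.
Proof. by rewrite /cons_measure /pushforward preimage_set0 measure0. Qed.

Let cons_measure_ge0 A : 0 <= cons_measure A.
Proof. by rewrite /cons_measure /pushforward measure_ge0. Qed.

Let cons_measure_sigma_additive : semi_sigma_additive cons_measure.
Proof.
have mcons A : measurable A -> measurable (@cons_rV n @^-1` A).
  by move=> mA; rewrite -[X in measurable X]setTI; exact: measurable_cons_rV.
move=> F mF tF mUF; rewrite /cons_measure /pushforward preimage_bigcup.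
apply: measure_semi_sigma_additive.
- by move=> k; exact: mcons.
- apply/trivIsetP => /= i j _ _ ij; rewrite -preimage_setI.
  by move/trivIsetP : tF => /(_ _ _ _ _ ij) ->//; rewrite preimage_set0.
- by rewrite -preimage_bigcup; exact: mcons.
Qed.

HB.instance Definition _ := isMeasure.Build _ _ _ cons_measure
  cons_measure0 cons_measure_ge0 cons_measure_sigma_additive.

Let cons_measure_sigma_finite : sigma_finite setT cons_measure.
Proof.
have /sigma_finiteP[F [TF ndF mF]] :=
  sigma_finiteT (@lebesgue_measure R : {sigma_finite_measure set _ -> \bar R}).
have /sigma_finiteP[G [TG ndG mG]] := sigma_finiteT mu.
exists (fun k => @uncons_rV n @^-1` (F k `*` G k)).
  rewrite -preimage_bigcup (_ : \bigcup_k _ = setT) ?preimage_setT//.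
  rewrite -setXTT TF TG; apply/seteqP; split=> [[x y] [k _ []]|[x y] /= []].
    by split; exists k.
  move=> [i _ Fx] [j _ Gy]; exists (maxn i j) => //; split.
  - by move: x Fx; exact/subsetPset/ndF/leq_maxl.
  - by move: y Gy; exact/subsetPset/ndG/leq_maxr.
move=> k; have [mFk Fk] := mF k; have [mGk Gk] := mG k; split.
  rewrite -[X in measurable X]setTI; apply: measurable_uncons_rV => //.
  exact: measurableX.
rewrite /cons_measure /pushforward -comp_preimage.
rewrite (_ : _ \o _ = id) ?preimage_id; last by apply/funext; exact: cons_rVK.
by rewrite product_measure1E// lte_mul_pinfty// ge0_fin_numE.
Qed.

HB.instance Definition _ := Measure_isSigmaFinite.Build _ _ _
  cons_measure cons_measure_sigma_finite.

End cons_measure.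

Fixpoint lebesgue_rV n : {sigma_finite_measure set 'rV[R]_n -> \bar R} :=
  if n is m.+1 then cons_measure (lebesgue_rV m) else dirac (0 : 'rV[R]_0).

Lemma lebesgue_rV_box n (A : 'I_n -> set (measurableTypeR R)) :
  (forall i, measurable (A i)) ->
  lebesgue_rV n [set v | forall i, A i (v ord0 i)] =
  (\prod_i lebesgue_measure (A i))%E.
Proof.
elim: n => [|n IH] in A *.
  by move=> _; rewrite big_ord0 /= diracE mem_set// => -[].
move=> mA; rewrite big_ord_recl -IH//= /cons_measure /pushforward.
rewrite -product_measure1E//; last first.
  rewrite (_ : (fun _ => _) = \bigcap_(i in [set: 'I_n])
      ((fun v : 'rV[R]_n => v ord0 i) @^-1` A (lift ord0 i))); last first.
    by apply/seteqP; split=> v /= Av i => [_|]; exact: Av.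
  apply: fin_bigcap_measurable => // i _.
  by rewrite -[X in measurable X]setTI; apply: measurable_coord => //; exact: mA.
congr (_ _); apply/seteqP.
have c0 (p : R * 'rV[R]_n) : cons_rV p ord0 ord0 = p.1.
  by have /(congr1 fst) := cons_rVK p.
have cS (p : R * 'rV[R]_n) i : cons_rV p ord0 (lift ord0 i) = p.2 ord0 i.
  have /(congr1 snd)/rowP/(_ i) := cons_rVK p; rewrite mxE => <-.
  by congr (fun_of_matrix _ _ _); exact: val_inj.
split=> p /= => [Ap|[Ap0 ApS] i].
  by split=> [|i]; [rewrite -c0|rewrite -cS]; exact: Ap.
by case: (unliftP ord0 i) => [j|] ->; rewrite ?cS ?c0.
Qed.

End lebesgue_rV.

Section frobenius.
Context (R : realType) (m n : nat).

Definition mxdot (A B : 'M[R]_(m, n)) : R := \tr (A^T *m B).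

(* The norm `|A| of 'M[R]_(m, n) in the library is the maximum of the absolute
   values of the entries, hence the separate definition. *)
Definition frob (A : 'M[R]_(m, n)) : R := Num.sqrt (mxdot A A).

End frobenius.

Section sobolev.
Context (R : realType) (n : nat).
Implicit Types (f g phi : 'rV[R]_n -> R) (z : 'rV[R]_n -> 'rV[R]_n).
Implicit Types (U : set 'rV[R]_n) (G : 'rV[R]_n -> 'M[R]_n).

Definition partial (i : 'I_n) f : 'rV[R]_n -> R :=
  fun x => 'D_(delta_mx ord0 i) f x.

Definition smooth f := forall s : seq 'I_n,
  let g := foldr partial f s in
  continuous g /\ forall i x, derivable g x (delta_mx ord0 i).

(* C_c^oo(U); its elements are functions on R^n, i.e. extended by 0 outside U *)
Definition test_function U phi :=
  [/\ smooth phi, compact (closure [set x | phi x != 0]) &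
      closure [set x | phi x != 0] `<=` U].

Definition square_integrable U f :=
  measurable_fun U f /\
  (\int[lebesgue_rV R n]_(x in U) (f x ^+ 2)%:E < +oo)%E.

Definition weak_partial U (i : 'I_n) f g := forall phi, test_function U phi ->
  \int[lebesgue_rV R n]_(x in U) (f x * partial i phi x) =
  - \int[lebesgue_rV R n]_(x in U) (g x * phi x).

(* (grad z)_(i, j) = d z_i / d x_j *)
Definition grad z : 'rV[R]_n -> 'M[R]_n :=
  fun x => \matrix_(i, j) partial j (fun y => z y ord0 i) x.

(* z belongs to W^1_2(U, R^n) and G is its weak gradient *)
Definition W12 U z G :=
  [/\ forall i, square_integrable U (fun x => z x ord0 i),
      forall i j, square_integrable U (fun x => G x i j) &
      forall i j,
        weak_partial U j (fun x => z x ord0 i) (fun x => G x i j)].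

Definition W12_sqnorm U z G : \bar R :=
  (\int[lebesgue_rV R n]_(x in U) (frob (z x) ^+ 2 + frob (G x) ^+ 2)%:E)%E.

(* z lies in the W^1_2-closure of C_c^oo(U, R^n), where G is the weak gradient
   of z *)
Definition zero_trace U z G := forall e : R, 0 < e ->
  exists phi : 'rV[R]_n -> 'rV[R]_n,
    (forall i, test_function U (fun x => phi x ord0 i)) /\
    (W12_sqnorm U (z \- phi)%R (G \- grad phi)%R < e%:E)%E.

Definition korn_inequality (M : 'M[R]_n -> 'M[R]_n) (gamma : R) :=
  forall U, open U -> bounded_set U ->
  forall z G, W12 U z G -> zero_trace U z G ->
  (\int[lebesgue_rV R n]_(x in U) (frob (G x) ^+ 2)%:E <=
   gamma%:E * \int[lebesgue_rV R n]_(x in U) (mxdot (M (G x)) (G x))%:E)%E.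

End sobolev.

Section viscous_stress.
Context (R : realType) (n : nat).
Implicit Types F Q A : 'M[R]_n.

Definition sym A : 'M[R]_n := 2^-1 *: (A + A^T).

Definition stress (m : nat) F Q : 'M[R]_n :=
  sym (Q *m invmx F) ^+ (2 * m + 1) *m (invmx F)^T.

Definition stress0' F Q : 'M[R]_n :=
  (2 * \det F) *: (sym (Q *m invmx F) *m (invmx F)^T).

Definition stress0'' F Q : 'M[R]_n := 2 *: (F *m sym (F^T *m Q)).

Definition D2 (Z : 'M[R]_n -> 'M[R]_n -> 'M[R]_n) F Q : 'M[R]_n -> 'M[R]_n :=
  'd (Z F) Q.

End viscous_stress.

(* Main.v *)
Require Import Defs.
From HB Require Import structures.
From mathcomp Require Import all_boot all_order all_algebra.
From mathcomp Require Import all_classical all_reals all_analysis.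
From mathcomp Require Import measurable_realfun ring lra.

Set Implicit Arguments.
Unset Strict Implicit.
Unset Printing Implicit Defensive.

Import Order.TTheory GRing.Theory Num.Theory.
Import numFieldNormedType.Exports.

Local Open Scope classical_set_scope.
Local Open Scope ring_scope.

(* For zeta in C_c^oo and a constant matrix C, the difference
   tr((grad zeta C)^2) - (tr(grad zeta C))^2 is a combination of 2 x 2 minors of
   grad zeta, so it has zero integral; hence the integral of tr((grad zeta C)^2)
   is nonnegative, also for zeta of zero trace by approximation. As
   2 |sym X|^2 = |X|^2 + tr(X^2), this is Korn's inequality with constant 2 for
   X = grad zeta C, and the theorem reduces to the pointwise bounds
   |A|^2 + c tr((A C)^2) <= gamma (M A : A), with C = F0^T in case (i) and
   C = F0^-1 in the other cases. *)

(** * The Frobenius inner product and symmetric parts *)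

(** The constant matrix C stays in the algebra: there is no change of variables by F0, so U is never
    transformed. The null Lagrangian is integrated over all of R^n, where the test functions already
    vanish outside U, so the boundary of U does not enter. The constants arise as follows.
    Submultiplicativity of the Frobenius norm gives |A|^2 <= |F0|^2 |A F0^-1|^2, and the identity
    for 2 |sym X|^2 then costs 2 |F0|^2, as in (iii). In (i) and (ii) the factor 2 in the stress
    tensor absorbs this 2. In (iv) and (v), with S = sym (Q0 F0^-1), each factor |S^-1|^2 is the
    price of stripping one S from S E or S S E. *)

Section frobenius_lemmas.
Context (R : realType).

Lemma mxdotE m n (A B : 'M[R]_(m, n)) :
  mxdot A B = \sum_i \sum_j A i j * B i j.
Proof.
rewrite /mxdot /mxtrace exchange_big /=; apply: eq_bigr => j _.
by rewrite mxE; apply: eq_bigr => i _; rewrite mxE.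
Qed.

Lemma mxdot_ge0 m n (A : 'M[R]_(m, n)) : 0 <= mxdot A A.
Proof.
rewrite mxdotE; apply: sumr_ge0 => i _; apply: sumr_ge0 => j _.
by rewrite -expr2 sqr_ge0.
Qed.

Lemma sqr_frob m n (A : 'M[R]_(m, n)) : frob A ^+ 2 = mxdot A A.
Proof. by rewrite sqr_sqrtr// mxdot_ge0. Qed.

Lemma mxdotC m n (A B : 'M[R]_(m, n)) : mxdot A B = mxdot B A.
Proof. by rewrite /mxdot -mxtrace_tr trmx_mul trmxK. Qed.

Lemma mxdot_tr m n (A B : 'M[R]_(m, n)) : mxdot A^T B^T = mxdot A B.
Proof. by rewrite /mxdot trmxK mxtrace_mulC -/(mxdot B A) mxdotC. Qed.

Lemma mxdotDl m n (A B C : 'M[R]_(m, n)) :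
  mxdot (A + B) C = mxdot A C + mxdot B C.
Proof. by rewrite /mxdot linearD mulmxDl linearD. Qed.

Lemma mxdotDr m n (A B C : 'M[R]_(m, n)) :
  mxdot C (A + B) = mxdot C A + mxdot C B.
Proof. by rewrite /mxdot mulmxDr linearD. Qed.

Lemma mxdotZl m n (a : R) (A B : 'M[R]_(m, n)) : mxdot (a *: A) B = a * mxdot A B.
Proof. by rewrite /mxdot linearZ /= -scalemxAl linearZ. Qed.

Lemma mxdotZr m n (a : R) (A B : 'M[R]_(m, n)) : mxdot A (a *: B) = a * mxdot A B.
Proof. by rewrite /mxdot -scalemxAr linearZ. Qed.

(** Lagrange's identity: twice the defect is the sum of the squares of x_i y_j - x_j y_i. *)
Lemma sum_cauchy_schwarz (I : finType) (x y : I -> R) :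
  (\sum_i x i * y i) ^+ 2 <= (\sum_i x i ^+ 2) * (\sum_i y i ^+ 2).
Proof.
rewrite -subr_ge0 -(pmulr_rge0 _ (ltr0n R 2)).
have -> : 2 * ((\sum_i x i ^+ 2) * (\sum_i y i ^+ 2) - (\sum_i x i * y i) ^+ 2) =
    \sum_i \sum_j (x i * y j - x j * y i) ^+ 2.
  set a := \sum_i x i ^+ 2; set b := \sum_i y i ^+ 2; set c := \sum_i x i * y i.
  have -> : 2 * (a * b - c ^+ 2) = (a * b - c * c) + (b * a - c * c) by ring.
  rewrite !big_distrlr /= -!sumrB -big_split /=; apply: eq_bigr => i _.
  rewrite -!sumrB -big_split /=; apply: eq_bigr => j _.
  by ring.
by apply: sumr_ge0 => i _; apply: sumr_ge0 => j _; exact: sqr_ge0.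
Qed.

(** Cauchy-Schwarz for each entry of the product, a row of A against a column of B. *)
Lemma mxdot_mulmx m n p (A : 'M[R]_(m, n)) (B : 'M[R]_(n, p)) :
  mxdot (A *m B) (A *m B) <= mxdot A A * mxdot B B.
Proof.
rewrite !mxdotE [X in _ * X]exchange_big big_distrlr /=.
apply: ler_sum => i _; apply: ler_sum => j _.
rewrite -expr2 mxE.
exact: (sum_cauchy_schwarz (fun k => A i k) (fun k => B k j)).
Qed.

End frobenius_lemmas.

(** * Symmetric parts and the derivatives of odd powers *)

Section symmetric_part.
Context (R : realType) (n : nat).
Implicit Types A B E F S X Y : 'M[R]_n.

Lemma mxdot_mulmxr X A B : mxdot (X *m B^T) A = mxdot X (A *m B).
Proof. by rewrite /mxdot trmx_mul trmxK -mulmxA mxtrace_mulC mulmxA. Qed.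

Lemma mxdot_mulmxl X A F : mxdot (F *m X) A = mxdot X (F^T *m A).
Proof. by rewrite /mxdot trmx_mul -mulmxA. Qed.

Lemma trmx_sym A : (sym A)^T = sym A.
Proof. by rewrite /sym linearZ linearD /= trmxK addrC. Qed.

(** The skew part of Y is orthogonal to every symmetric matrix. *)
Lemma mxdot_symr X Y : X^T = X -> mxdot X (sym Y) = mxdot X Y.
Proof.
move=> XT; rewrite /sym mxdotZr mxdotDr -[X in _ + mxdot X _]XT mxdot_tr.
by rewrite -mulr2n mulrC -[_ *+ 2]mulr_natr mulfK.
Qed.

Lemma mxdot_sym A : 2 * mxdot (sym A) (sym A) = mxdot A A + \tr (A *m A).
Proof.
rewrite mxdot_symr ?trmx_sym// /sym mxdotZl mulrA divff// mul1r mxdotDl.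
by rewrite [mxdot A^T A]/mxdot trmxK.
Qed.

Lemma mxdot_le_unitr A F : F \in unitmx ->
  mxdot A A <= mxdot (A *m invmx F) (A *m invmx F) * mxdot F F.
Proof. by move=> Fu; rewrite -{1 2}(mulmxKV Fu A) mxdot_mulmx. Qed.

Lemma mxdot_le_unitl A S : S \in unitmx ->
  mxdot A A <= mxdot (invmx S) (invmx S) * mxdot (S *m A) (S *m A).
Proof. by move=> Su; rewrite -{1 2}(mulKmx Su A) mxdot_mulmx. Qed.

(* The left factors below are the derivatives of S |-> S ^+ 3 and S |-> S ^+ 5 in
   direction E. In an eigenbasis of S, with eigenvalues a and b, the identities
   read a^2 + a b + b^2 = (a^2 + b^2) / 2 + (a + b)^2 / 2 and
   a^4 + a^3 b + a^2 b^2 + a b^3 + b^4 = (a^4 + b^4) / 2 +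
   (a^2 + b^2) (a + b)^2 / 2. *)
Lemma mxdot_pow3 S E : S^T = S -> E^T = E ->
  2 * mxdot (E *m (S *m S) + S *m (E *m S + S *m E)) E =
  2 * mxdot (S *m E) (S *m E) + mxdot (S *m E + E *m S) (S *m E + E *m S).
Proof.
move=> ST ET; rewrite !(mxdotDl, mxdotDr, mulmxDr) /mxdot !trmx_mul !ST !ET !mulmxA.
(* Words in S and E have the same trace up to cyclic rotation. The rewrites rotate the words to
   common representatives, which [ring] then treats as atoms. *)
have r A B : \tr (A *m B) = \tr (B *m A) by exact: mxtrace_mulC.
rewrite [\tr (S *m E *m E *m S)]r !mulmxA.
rewrite [\tr (S *m S *m E *m E)]r [\tr (S *m E *m S *m E)]r !mulmxA.
by ring.
Qed.

Lemma mxdot_pow5 S E : S^T = S -> E^T = E ->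
  mxdot ((E *m S + S *m E) *m (S *m (S *m S)) +
    (S *m S) *m (E *m (S *m S) + S *m (E *m S + S *m E))) E =
  mxdot (S *m (S *m E)) (S *m (S *m E)) +
  mxdot (S *m (S *m E + E *m S)) (S *m (S *m E + E *m S)).
Proof.
move=> ST ET.
rewrite !(mxdotDl, mxdotDr, mulmxDr, mulmxDl) /mxdot !trmx_mul !ST !ET !mulmxA.
have r A B : \tr (A *m B) = \tr (B *m A) by exact: mxtrace_mulC.
rewrite [\tr (S *m S *m S *m S *m E *m E)]r.
rewrite [\tr (S *m S *m S *m E *m S *m E)]r.
rewrite [\tr (S *m E *m S *m S *m E *m S)]r !mulmxA.
rewrite [\tr (E *m S *m S *m S *m E *m S)]r !mulmxA.
by ring.
Qed.

(** Symmetry of this derivative is what allows [mxdot_symr] to replace A F0^-1 by its symmetric part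
    E. *)
Lemma trmx_pow3 S E : S^T = S -> E^T = E ->
  (E *m (S *m S) + S *m (E *m S + S *m E))^T =
  E *m (S *m S) + S *m (E *m S + S *m E).
Proof.
move=> ST ET; rewrite !mulmxDr !linearD /= !trmx_mul ST ET !mulmxA.
by rewrite addrC [in LHS](addrC (S *m E *m S)) -addrA.
Qed.

Lemma trmx_pow5 S E : S^T = S -> E^T = E ->
  ((E *m S + S *m E) *m (S *m (S *m S)) +
    (S *m S) *m (E *m (S *m S) + S *m (E *m S + S *m E)))^T =
  (E *m S + S *m E) *m (S *m (S *m S)) +
    (S *m S) *m (E *m (S *m S) + S *m (E *m S + S *m E)).
Proof.
move=> ST ET; rewrite !(mulmxDr, mulmxDl) !linearD /= !trmx_mul ST ET !mulmxA.
set a := E *m S *m S *m S *m S; set b := S *m E *m S *m S *m S.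
set c := S *m S *m E *m S *m S; set d := S *m S *m S *m E *m S.
set e := S *m S *m S *m S *m E.
by rewrite addrC [in LHS](addrC c) [b + a]addrC [e + d]addrC -addrA.
Qed.

(** Of the two squares in [mxdot_pow3] only |S E|^2 is kept, and it controls |E|^2 because S is
    invertible. *)
Lemma mxdot_pow3_ge S E : S^T = S -> E^T = E -> S \in unitmx ->
  mxdot E E <= mxdot (invmx S) (invmx S) *
    mxdot (E *m (S *m S) + S *m (E *m S + S *m E)) E.
Proof.
move=> ST ET Su; apply: le_trans (mxdot_le_unitl E Su) _.
rewrite ler_wpM2l ?mxdot_ge0//.
have := mxdot_pow3 ST ET; have := mxdot_ge0 (S *m E + E *m S); lra.
Qed.

(** Here |S S E|^2 is kept; removing S twice explains the square of the norm of S^-1. *)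
Lemma mxdot_pow5_ge S E : S^T = S -> E^T = E -> S \in unitmx ->
  mxdot E E <= mxdot (invmx S) (invmx S) ^+ 2 *
    mxdot ((E *m S + S *m E) *m (S *m (S *m S)) +
    (S *m S) *m (E *m (S *m S) + S *m (E *m S + S *m E))) E.
Proof.
move=> ST ET Su; apply: le_trans (mxdot_le_unitl E Su) _.
rewrite expr2 -mulrA ler_wpM2l ?mxdot_ge0//.
apply: le_trans (mxdot_le_unitl _ Su) _.
by rewrite ler_wpM2l ?mxdot_ge0// mxdot_pow5// lerDl mxdot_ge0.
Qed.

End symmetric_part.

(** * Differentials of matrix-valued maps *)

Section matrix_differential.
Context (R : realType).

Lemma continuous_sum (T : topologicalType) (W : normedModType R) (I : finType)
    (F : I -> T -> W) :
  (forall i, continuous (F i)) -> continuous (fun x => \sum_i F i x).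
Proof.
move=> cF.
exact: (@continuous_big W I _ 0 xpredT (@add_continuous W) T (index_enum I) F
  (fun i _ => cF i)).
Qed.

Lemma linear_mx_continuous m n (W : normedModType R)
    (L : {linear 'M[R]_(m, n) -> W}) :
  continuous L.
Proof.
have -> : (L : _ -> _) =
    fun A => \sum_i \sum_j A i j *: L (delta_mx i j).
  apply/funext => A; rewrite [in LHS](matrix_sum_delta A) linear_sum.
  by apply: eq_bigr => i _; rewrite linear_sum; apply: eq_bigr => j _; rewrite linearZ.
do 2 apply: continuous_sum => ?.
by move=> A; exact: (cvgZr_tmp (@coord_continuous R m n _ _ A)).
Qed.

Lemma is_diff_linear_mx m n (W : normedModType R)
    (L : {linear 'M[R]_(m, n) -> W}) A :
  is_diff A L L.
Proof.
apply: DiffDef; first exact/linear_differentiable/linear_mx_continuous.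
by rewrite diff_lin//; exact: linear_mx_continuous.
Qed.

(** Joint continuity is what differentiating a bilinear map requires. Expanding the left factor in
    the basis of elementary matrices leaves products of a scalar and a matrix. *)
Lemma mulmx_continuous m n p :
  continuous (fun AB : 'M[R]_(m, n) * 'M[R]_(n, p) => AB.1 *m AB.2).
Proof.
have -> : (fun AB : 'M[R]_(m, n) * 'M[R]_(n, p) => AB.1 *m AB.2) =
    fun AB => \sum_i \sum_j AB.1 i j *: (delta_mx i j *m AB.2).
  apply/funext => -[A B] /=; rewrite [in LHS](matrix_sum_delta A) mulmx_suml.
  apply: eq_bigr => i _; rewrite mulmx_suml.
  by apply: eq_bigr => j _; rewrite scalemxAl.
apply: continuous_sum => i; apply: continuous_sum => j -[A B].
have cA : continuous_at (A, B) (fun AB => AB.1 i j : R).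
  apply: (@continuous_comp _ _ _ fst (fun A : 'M[R]_(m, n) => A i j : R) (A, B)).
    exact: cvg_fst.
  exact: coord_continuous.
have cB : continuous_at (A, B) (fun AB => delta_mx i j *m AB.2 : 'M[R]_(m, p)).
  apply: (@continuous_comp _ _ _ snd
    (fun B : 'M[R]_(n, p) => delta_mx i j *m B : 'M[R]_(m, p)) (A, B)).
    exact: cvg_snd.
  exact: (@linear_mx_continuous _ _ _ (mulmx (delta_mx i j))).
exact: cvgZ cA cB.
Qed.

Lemma is_diff_mulmx (V : normedModType R) m n p (f df : V -> 'M[R]_(m, n))
    (g dg : V -> 'M[R]_(n, p)) x :
  is_diff x f df -> is_diff x g dg ->
  is_diff x (fun y => f y *m g y) (fun v => df v *m g x + f x *m dg v).
Proof.
move=> dfx dgx.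
have mul_diff : is_diff (f x, g x)
    (fun q : 'M[R]_(m, n) * 'M[R]_(n, p) => q.1 *m q.2)
    (fun q => f x *m q.2 + q.1 *m g x).
  apply: DiffDef.
    exact: (@differentiable_bilin _ _ _ _ (@mulmx R m n p) _ (@mulmx_continuous m n p)).
  exact: (@diff_bilin _ _ _ _ (@mulmx R m n p) _ (@mulmx_continuous m n p)).
apply: (is_diff_eq (is_diff_comp (is_diff_pair dfx dgx) mul_diff)).
by apply/funext => v /=; rewrite addrC.
Qed.

End matrix_differential.

(** * Lebesgue measure on row vectors *)

Lemma mxentry_le_norm (R : realDomainType) m n (A : 'M[R]_(m, n)) i j :
  `|A i j| <= `|A|.
Proof.
rewrite [leRHS]/Num.Def.normr /= mx_normrE.
exact: (le_bigmax _ (fun ij : 'I_m * 'I_n => `|A ij.1 ij.2|) (i, j)).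
Qed.

(** The sigma-algebra is generated by cylinders, so A is written as the union of those boxes with
    rational centre and radius 1/(k+1) that it contains: a countable union of finite intersections
    of cylinders. *)
Lemma open_measurable_rV (R : realType) n (A : set 'rV[R]_n) :
  open A -> measurable A.
Proof.
move=> oA.
pose box (p : 'rV[rat]_n * nat) : set 'rV[R]_n :=
  [set v | forall i, `|v ord0 i - ratr (p.1 ord0 i)| < p.2.+1%:R^-1].
have -> : A = \bigcup_p (if `[< box p `<=` A >] then box p else set0).
  apply/seteqP; split=> [x Ax|x [p _]]; last by case: asboolP => // + pA; exact.
  have /nbhs_ballP[e /= e0 xeA] := open_nbhs_nbhs (conj oA Ax).
  (* With 1/(k+1) < e/2, every box of radius 1/(k+1) that contains x lies in the ball of radius e
     around x. *)
  have [k] := ltr_add_invr (divr_gt0 e0 (ltr0n R 2)); rewrite add0r => ke.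
  have k0 : 0 < k.+1%:R^-1 :> R by rewrite invr_gt0.
  have /choice[q qx] : forall i, exists q : rat,
      `|x ord0 i - ratr q| < k.+1%:R^-1.
    move=> i; have /rat_in_itvoo[q] :
        x ord0 i - k.+1%:R^-1 < x ord0 i + k.+1%:R^-1.
      by rewrite ltrD2l gtrN.
    rewrite in_itv/= => /andP[lq uq]; exists q.
    by rewrite distrC ltr_distl lq.
  exists (\row_i q i, k) => //; case: asboolP => [_ i|]; first by rewrite /= mxE.
  case=> v /= vq; apply: xeA; split => // i j; rewrite ord1 /ball /=.
  have := vq j; rewrite mxE => vqj.
  rewrite (_ : x _ _ - v _ _ =
      (x ord0 j - ratr (q j)) - (v ord0 j - ratr (q j))); last first.
    by rewrite opprB addrA subrK.
  apply: (le_lt_trans (ler_normB _ _)).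
  by rewrite (splitr e); apply: ltrD; apply: lt_trans ke.
apply: countable_bigcupT_measurable; first exact: countableP.
move=> p; case: ifP => // _.
rewrite (_ : box p = \bigcap_(i in [set: 'I_n])
    ((fun v : 'rV[R]_n => v ord0 i) @^-1`
       [set y : R | `|y - ratr (p.1 ord0 i)| < p.2.+1%:R^-1])); last first.
  by apply/seteqP; split=> v /= bv i => [_|]; exact: bv.
apply: fin_bigcap_measurable => // i _.
rewrite -[X in measurable X]setTI; apply: measurable_coord => //.
rewrite (_ : [set _ | _] =
    ball (ratr (p.1 ord0 i) : R) p.2.+1%:R^-1); last first.
  by apply/seteqP; split=> y; rewrite /ball /= distrC.
by exact: measurable_ball.
Qed.

Lemma continuous_measurable_rV (R : realType) n (f : 'rV[R]_n -> R) :
  continuous f -> measurable_fun setT f.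
Proof.
move=> cf; apply: (measurability _ (RGenOInfty.measurableE R)) => //.
move=> _ [_ [a ->] <-]; rewrite setTI; apply: open_measurable_rV.
by move/continuousP : cf; apply; exact: itv_open_ends_open.
Qed.

(** The image of Lebesgue measure under a translation agrees with it on half-open intervals, hence
    everywhere by uniqueness. *)
Lemma lebesgue_measure_shift (R : realType) (v : R) (A : set (measurableTypeR R)) :
  measurable A ->
  lebesgue_measure ((fun x => x + v) @^-1` A) = lebesgue_measure A.
Proof.
have mv : measurable_fun [set: measurableTypeR R]
    ((fun x => x + v) : measurableTypeR R -> measurableTypeR R).
  exact: measurable_funD.
move=> mA; apply/esym.
pose mu : {measure set (measurableTypeR R) -> \bar R} :=
  measure_function_pushforward__canonical__measure_function_Measure
    (@lebesgue_measure R) mv.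
apply: (@lebesgue_measure_unique _ mu) => // _ [[a b] _ <-].
rewrite /mu /= /pushforward.
rewrite (_ : _ @^-1` _ = `]a - v, b - v]%classic); last first.
  by apply/seteqP; split=> x; rewrite /= !in_itv/= ltrBlDr lerBrDr.
rewrite !lebesgue_measure_itv/= !lte_fin ltrD2r.
by case: ifP => // _; rewrite -!EFinB opprD addrACA subrr addr0.
Qed.

Lemma measurable_shift_rV (R : realType) n (v : 'rV[R]_n) :
  measurable_fun setT (fun x : 'rV[R]_n => x + v).
Proof.
apply: measurable_matrixP => i j; under eq_fun do rewrite mxE.
by apply: measurable_funD => //; exact: measurable_coord.
Qed.

(** In the coordinates given by [cons_rV] a translation is a product of translations, and a measure
    that agrees with the product measure on measurable rectangles is equal to it. *)
Lemma lebesgue_rV_shift (R : realType) n (v : 'rV[R]_n) (A : set 'rV[R]_n) :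
  measurable A -> lebesgue_rV R n ((fun x => x + v) @^-1` A) = lebesgue_rV R n A.
Proof.
elim: n v A => [|n IH] v A mA.
  congr (_ _); apply/seteqP; split=> x /=; rewrite (_ : x + v = x) //;
    by apply/rowP => -[].
pose w : 'rV[R]_n := (uncons_rV v).2.
pose T (p : measurableTypeR R * 'rV[R]_n) : measurableTypeR R * 'rV[R]_n :=
  (p.1 + v ord0 ord0, p.2 + w).
have mT : measurable_fun setT T.
  apply: measurable_fun_pair; first exact: measurable_funD.
  exact: (measurableT_comp (measurable_shift_rV w) measurable_snd).
rewrite /= /cons_measure /pushforward -comp_preimage.
have -> : (fun x => x + v) \o @cons_rV R n = @cons_rV R n \o T.
  apply/funext => -[x y] /=; apply/rowP => i; rewrite /cons_rV /T /w /= !mxE.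
  case: fintype.splitP => k /=; rewrite !mxE => ik; congr (_ + v _ _);
    apply: val_inj => //=.
  by rewrite ik ord1.
rewrite comp_preimage.
have : measurable (@cons_rV R n @^-1` A).
  by rewrite -[X in measurable X]setTI; exact: measurable_cons_rV.
move: (_ @^-1` A) => B mB.
pose mu : {measure set (measurableTypeR R * 'rV[R]_n) -> \bar R} :=
  measure_function_pushforward__canonical__measure_function_Measure
    (@lebesgue_measure R \x lebesgue_rV R n)%E mT.
apply/esym; apply: (@product_measure_unique _ _ _ _ _ _ _ mu) => // C D mC mD.
rewrite /mu /= /pushforward.
rewrite (_ : T @^-1` _ =
  ((fun x => x + v ord0 ord0) @^-1` C) `*` ((fun x => x + w) @^-1` D)) //.
rewrite product_measure1E.
- by congr (_ * _)%E; [exact: lebesgue_measure_shift|exact: IH].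
- by rewrite -[X in measurable X]setTI; exact: measurable_funD.
- by rewrite -[X in measurable X]setTI; exact: measurable_shift_rV.
Qed.

(** * Integrals of continuous functions of bounded support *)

Section bounded_support.
Context (R : realType) (n : nat).
Local Notation mu := (lebesgue_rV R n).
Implicit Types (f g : 'rV[R]_n -> R) (v x : 'rV[R]_n).

Lemma closed_norm_le (r : R) : closed [set x : 'rV[R]_n | `|x| <= r].
Proof.
rewrite (_ : [set _ | _] = @Num.Def.normr _ 'rV[R]_n @^-1` [set y | y <= r])//.
by apply: closed_comp; [move=> x _; exact: norm_continuous|exact: closed_le].
Qed.

Lemma measurable_norm_le (r : R) : measurable [set x : 'rV[R]_n | `|x| <= r].
Proof.
rewrite -[X in measurable X]setCK; apply: measurableC.
by apply: open_measurable_rV; apply: closed_openC; exact: closed_norm_le.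
Qed.

Lemma lebesgue_rV_norm_le_lty (r : R) :
  (mu [set x : 'rV[R]_n | (`|x| <= r)%R] < +oo)%E.
Proof.
(* The norm is the maximum norm, so the ball lies in this cube. *)
have box : (mu [set v | forall i, `[(- r)%R, r]%classic (v ord0 i)] < +oo)%E.
  rewrite (@lebesgue_rV_box R n (fun=> `[- r, r]%classic))//.
  rewrite ltey_eq; apply/orP; left.
  apply: (@big_ind _ (fun y => y \is a fin_num)) => // [y z|i _].
    exact: fin_numM.
  by rewrite lebesgue_measure_itv/=; case: ifP.
have mbox : measurable [set v : 'rV[R]_n | forall i, `[- r, r]%classic (v ord0 i)].
  rewrite (_ : [set _ | _] = \bigcap_(i in [set: 'I_n])
    ((fun v : 'rV[R]_n => v ord0 i) @^-1` `[- r, r]%classic)); last first.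
    by apply/seteqP; split=> v /= bv i => [_|]; exact: bv.
  apply: fin_bigcap_measurable => // i _.
  by rewrite -[X in measurable X]setTI; apply: measurable_coord.
apply: le_lt_trans box; apply: le_measure; rewrite ?inE//.
  exact: measurable_norm_le.
move=> x /= xr i; rewrite in_itv/= -ler_norml.
exact: le_trans (mxentry_le_norm _ _ _) xr.
Qed.

(** Measurability, rather than continuity, is assumed in order to cover also the multiple of an
    indicator that serves as dominating function in [integral_dquot_cvg]. *)
Lemma bounded_support_integrable f (M r : R) : measurable_fun setT f ->
  (forall x, `|f x| <= M) -> (forall x, r < `|x| -> f x = 0) ->
  mu.-integrable setT (EFin \o f).
Proof.
move=> mf fM fr.
have -> : EFin \o f = (EFin \o f) \_ [set x : 'rV[R]_n | `|x| <= r].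
  apply/funext => x; rewrite patchE; case: ifPn => // /negP.
  by rewrite inE/= => /negP; rewrite -ltNge => /fr /= ->.
apply/(integrable_mkcond _ (measurable_norm_le r)).
apply: measurable_bounded_integrable.
- exact: measurable_norm_le.
- exact: lebesgue_rV_norm_le_lty.
- exact: measurable_funTS.
- exists M; split; first exact: num_real.
  by move=> y My x _ /=; rewrite (le_trans (fM x))// ltW.
Qed.

(** This is C_c(R^n), with the support encoded by a radius: stability under shifts and differences
    becomes arithmetic of radii. *)
Definition continuous_bounded_support f :=
  continuous f /\ exists r : R, forall x, r < `|x| -> f x = 0.

Local Notation cbs := continuous_bounded_support.

Lemma cbs_bounded f : cbs f -> exists M, forall x, `|f x| <= M.
Proof.
case=> cf [r fr].
have : compact (f @` [set x : 'rV[R]_n | `|x| <= r]).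
  apply: continuous_compact; first exact: continuous_subspaceT.
  apply: bounded_closed_compact; last exact: closed_norm_le.
  by exists r; split; [exact: num_real|move=> y ry x /= /le_trans->//; exact: ltW].
(* Every number above N is a bound on the ball; |N| + 1 is moreover nonnegative, as needed where f
   vanishes. *)
move=> /compact_bounded[N [_ Nf]]; exists (`|N| + 1) => x.
have [xr|/fr->] := leP `|x| r; last by rewrite normr0 addr_ge0.
by apply: (Nf (`|N| + 1)); [rewrite ltr_pwDr// ler_norm|exists x].
Qed.

Lemma cbs_integrable f : cbs f -> mu.-integrable setT (EFin \o f).
Proof.
move=> cbsf; have [M fM] := cbs_bounded cbsf; have [cf [r fr]] := cbsf.
exact: bounded_support_integrable (continuous_measurable_rV cf) fM fr.
Qed.

Lemma cbs_shift f v : cbs f -> cbs (fun x => f (x + v)).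
Proof.
case=> cf [r fr]; split.
  move=> x; apply: (@continuous_comp _ _ _ (fun x => x + v) f); last exact: cf.
  exact: (cvgD (@cvg_id _ _) (cvg_cst v)).
exists (r + `|v|) => x rx; apply: fr.
by rewrite -(ltrD2r `|v|) (lt_le_trans rx)// -[in leLHS](addrK v x) ler_normB.
Qed.

Lemma cbsM f g : cbs f -> cbs g -> cbs (fun x => f x * g x).
Proof.
move=> [cf [r fr]] [cg _]; split; last by exists r => x /fr ->; rewrite mul0r.
by move=> x; apply: continuousM; [exact: cf|exact: cg].
Qed.

Lemma cbsB f g : cbs f -> cbs g -> cbs (fun x => f x - g x).
Proof.
move=> [cf [r fr]] [cg [s gs]]; split.
  by move=> x; apply: continuousB; [exact: cf|exact: cg].
by exists (Num.max r s) => x; rewrite gt_max => /andP[/fr-> /gs->]; rewrite subrr.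
Qed.

Lemma cbsZ f (a : R) : cbs f -> cbs (fun x => f x * a).
Proof.
move=> [cf [r fr]]; split; last by exists r => x /fr ->; rewrite mul0r.
by move=> x; apply: (@continuousM _ _ f (cst a)); [exact: cf|exact: cst_continuous].
Qed.

Lemma integral_cbs_shift f v : cbs f ->
  (\int[mu]_x (f (x + v))%:E = \int[mu]_x (f x)%:E)%E.
Proof.
move=> cbsf; have mv := measurable_shift_rV v.
have := @integral_pushforward _ _ _ _ R _ mv mu setT (EFin \o f).
rewrite preimage_setT => <-//; last first.
- exact: (cbs_integrable (cbs_shift v cbsf)).
- by apply/measurable_EFinP; apply: continuous_measurable_rV; case: cbsf.
apply: eq_measure_integral => A mA _; exact: (lebesgue_rV_shift v mA).
Qed.

End bounded_support.

(** * Null Lagrangians *)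

Section null_lagrangian.
Context (R : realType) (n : nat).
Local Notation mu := (lebesgue_rV R n).
Implicit Types (f g : 'rV[R]_n -> R) (v w x : 'rV[R]_n).

Local Notation cbs := (@continuous_bounded_support R n).

Lemma derive_near0 f x v : (\forall y \near x, f y = 0) -> 'D_v f x = 0.
Proof.
move=> f0; apply: lim_near_cst => //.
have hx : (h *: v + x) @[h --> 0^'] --> x.
  have : (h *: v + x) @[h --> (0 : R)] --> 0 *: v + x.
    by apply: cvgD; [apply: cvgZr_tmp; exact: cvg_id|exact: cvg_cst].
  rewrite scale0r add0r => h0; refine (cvg_trans _ h0).
  by apply: cvg_app; exact: nbhs_dnbhs.
near=> h; rewrite (_ : (f \o shift x) (h *: v) = 0); last by near: h; exact: hx _ f0.
by rewrite (nbhs_singleton f0) subrr scaler0.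
Unshelve. all: by end_near. Qed.

(** Regularity in one direction suffices for the mean value theorem on lines parallel to v.
    Continuity makes the derivative bounded, since its support is bounded too. *)
Definition C1_along v f := [/\ cbs f, forall x, derivable f x v &
  continuous (fun x => 'D_v f x)].

Lemma cbs_derive f v : C1_along v f -> cbs (fun x => 'D_v f x).
Proof.
case=> -[_ [r fr]] _ cDf; split => //; exists r => x rx.
have oA : open [set y : 'rV[R]_n | r < `|y|].
  rewrite (_ : mkset _ = ~` [set x : 'rV[R]_n | `|x| <= r]).
    exact/closed_openC/closed_norm_le.
  by apply/seteqP; split=> y /=; rewrite ltNge => /negP.
by apply: derive_near0; apply: (filterS fr); exact: open_nbhs_nbhs.
Qed.

Definition dquot (s : R) v f x : R := (f (x + s *: v) - f x) / s.

Lemma dquotN s v f x : dquot (- s) v f x = dquot s v f (x - s *: v).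
Proof. by rewrite /dquot scaleNr subrK invrN mulrN -mulNr opprB. Qed.

Lemma cbs_dquot s v f : cbs f -> cbs (dquot s v f).
Proof. by move=> cf; apply/cbsZ/cbsB => //; exact: cbs_shift. Qed.

(** The mean value theorem along t |-> x + t v gives the bound sup |D_v f|, independent of the step
    as dominated convergence demands. A negative step is a positive one from a shifted base
    point. *)
Lemma dquot_bounded f v : C1_along v f ->
  exists M : R, forall (s : R) x, s != 0 -> `|dquot s v f x| <= M.
Proof.
move=> C1f; have [M DfM] := cbs_bounded (cbs_derive C1f).
case: C1f => -[cf _] df _; exists M.
have pos (s : R) x : 0 < s -> `|dquot s v f x| <= M.
  move=> s0; pose phi (t : R) := f (x + t *: v).
  have phiE (t h : R) : phi (h *: 1 + t) = f (h *: v + (x + t *: v)).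
    by rewrite /phi [h *: 1]mulr1 scalerDl addrCA.
  have dphi (t : R) : is_derive t 1 phi ('D_v f (x + t *: v)).
    have E : (fun h => h^-1 *: ((phi \o shift t) (h *: 1) - phi t)) =
      (fun h => h^-1 *: ((f \o shift (x + t *: v)) (h *: v) - f (x + t *: v))).
      by apply/funext => h; rewrite /= phiE.
    apply: DeriveDef; first by rewrite /derivable E; exact: df.
    by rewrite /derive E.
  have cphi : {within `[0, s], continuous phi}.
    apply: derivable_within_continuous => t _; exact: (dphi t).(ex_derive).
  have [c _] := MVT s0 (fun t _ => dphi t) cphi.
  rewrite /phi scale0r addr0 subr0 => fE; rewrite /dquot fE mulfK ?gt_eqF//.
move=> s x s0; have [s_gt0|s_lt0|/eqP] := ltgtP 0 s; last by rewrite eq_sym (negbTE s0).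
  exact: pos.
by rewrite -[s]opprK dquotN; apply: pos; rewrite oppr_gt0.
Qed.

Lemma cvg_dquot f v x (u : R^nat) : derivable f x v ->
  (forall k, u k != 0) -> u @ \oo --> 0 ->
  dquot (u k) v f x @[k --> \oo] --> 'D_v f x.
Proof.
move=> df u0 cu.
have /cvgr_dnbhsP/(_ u (conj u0 cu)) :
    (fun h => h^-1 *: ((f \o shift x) (h *: v) - f x)) h @[h --> 0^'] -->
    'D_v f x by exact: df.
apply: cvg_trans; apply: near_eq_cvg; near=> k.
by rewrite /dquot /= [_ *: v + x]addrC mulrC.
Unshelve. all: by end_near. Qed.

Lemma integral_dquot_cvg f g v w (u : R^nat) : C1_along v f -> C1_along w g ->
  (forall k, u k != 0) -> (forall k, `|u k| <= 1) -> u @ \oo --> 0 ->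
  (\int[mu]_x (dquot (u k) v f x * dquot (u k) w g x)%:E @[k --> \oo] -->
   \int[mu]_x ('D_v f x * 'D_w g x)%:E)%E.
Proof.
move=> C1f C1g u0 u1 cu.
have [M fM] := dquot_bounded C1f; have [N gN] := dquot_bounded C1g.
have cbsDfg := cbsM (cbs_derive C1f) (cbs_derive C1g).
case: C1f => cbsf df _; case: C1g => cbsg dg _.
(* The support of f alone confines the product, and a step of size at most 1 enlarges its radius by
   at most |v|. *)
have [_ [r fr]] := cbsf; pose B := [set x : 'rV[R]_n | `|x| <= r + `|v|].
have M0 : 0 <= M by apply: le_trans (fM (u 0%N) 0 (u0 _)).
have N0 : 0 <= N by apply: le_trans (gN (u 0%N) 0 (u0 _)).
have mB : measurable B by exact: measurable_norm_le.
pose G x : R := M * N * \1_B x.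
have mG : measurable_fun setT G by exact: measurable_funM.
have [] // := @dominated_convergence _ _ _ mu setT measurableT
  (fun k x => (dquot (u k) v f x * dquot (u k) w g x)%:E)
  (fun x => ('D_v f x * 'D_w g x)%:E) (EFin \o G).
- move=> k; apply: (measurable_int mu); apply: cbs_integrable.
  by apply: cbsM; exact: cbs_dquot.
- exact: (measurable_int mu (cbs_integrable cbsDfg)).
- apply: aeW => x _; apply: cvg_EFin; first exact: nearW.
  by apply: cvgM; exact: cvg_dquot.
- apply: (@bounded_support_integrable _ _ _ (M * N) (r + `|v|)) => // x.
    rewrite /G normrM ger0_norm ?mulr_ge0// indicE ger0_norm//.
    by rewrite ler_piMr ?mulr_ge0// lern1 leq_b1.
  move=> rx; rewrite /G indicE memNset ?mulr0//.
  by apply/negP; rewrite -ltNge.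
- apply: aeW => x k _; rewrite /= lee_fin normrM /G indicE.
  have [xB|xB] := boolP (x \in B); first by rewrite mulr1 ler_pM// ?fM ?gN.
  have {}xB : r + `|v| < `|x|.
    by rewrite ltNge; apply: contra xB; rewrite inE.
  rewrite /dquot !fr ?subrr ?mul0r ?normr0 ?mul0r ?mulr0//.
    by apply: le_lt_trans xB; rewrite lerDl.
  rewrite -(ltrD2r `|v|) (lt_le_trans xB)//.
  rewrite -[in leLHS](addrK (u k *: v) x) (le_trans (ler_normB _ _))// lerD2l.
  by rewrite normrZ ler_piMl.
Qed.

Lemma integral_cbs4 (a b c d : 'rV[R]_n -> R) : cbs a -> cbs b -> cbs c -> cbs d ->
  (\int[mu]_x (a x - b x - (c x - d x))%:E =
   (\int[mu]_x (a x)%:E - \int[mu]_x (b x)%:E) -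
   (\int[mu]_x (c x)%:E - \int[mu]_x (d x)%:E))%E.
Proof.
move=> ca cb cc cd.
have intB p q : cbs p -> cbs q -> (\int[mu]_x (p x - q x)%:E =
    \int[mu]_x (p x)%:E - \int[mu]_x (q x)%:E)%E.
  move=> cp cq; under eq_integral do rewrite EFinB.
  by rewrite (integralB measurableT (cbs_integrable cp) (cbs_integrable cq)).
by rewrite (intB _ _ (cbsB ca cb) (cbsB cc cd)) !intB.
Qed.

(** Both products expand into four terms over s^2, in which the sign of s is invisible. Translating
    the first three terms on the right by s (v + w), s v and s w turns them into those on the left;
    the fourth ones coincide. *)
Lemma integral_dquot_exchange f g v w s : cbs f -> cbs g ->
  (\int[mu]_x (dquot s v f x * dquot s w g x)%:E =
   \int[mu]_x (dquot (- s) w f x * dquot (- s) v g x)%:E)%E.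
Proof.
move=> cf cg.
have E1 x : dquot s v f x * dquot s w g x =
    f (x + s *: v) * g (x + s *: w) / s ^+ 2 - f (x + s *: v) * g x / s ^+ 2
    - (f x * g (x + s *: w) / s ^+ 2 - f x * g x / s ^+ 2).
  by rewrite /dquot expr2 invfM; ring.
have E2 x : dquot (- s) w f x * dquot (- s) v g x =
    f (x - s *: w) * g (x - s *: v) / s ^+ 2 - f x * g (x - s *: v) / s ^+ 2
    - (f (x - s *: w) * g x / s ^+ 2 - f x * g x / s ^+ 2).
  by rewrite /dquot !scaleNr invrN expr2 invfM; ring.
under eq_integral do rewrite E1.
under [RHS]eq_integral do rewrite E2.
have cM p q : cbs p -> cbs q -> cbs (fun x => p x * q x / s ^+ 2).
  by move=> cp cq; apply/cbsZ/cbsM.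
have cs h y : cbs h -> cbs (fun x => h (x + y)) by exact: cbs_shift.
rewrite !integral_cbs4; try (by apply: cM => //; exact: cs).
congr (_ - _ - (_ - _))%E.
- rewrite -[RHS](integral_cbs_shift (s *: v + s *: w)); last by apply: cM; exact: cs.
  by apply: eq_integral => x _; rewrite addrA addrK [x + _ + _]addrAC addrK.
- rewrite -[RHS](integral_cbs_shift (s *: v)); last by apply: cM => //; exact: cs.
  by apply: eq_integral => x _; rewrite addrK.
- rewrite -[RHS](integral_cbs_shift (s *: w)); last by apply: cM => //; exact: cs.
  by apply: eq_integral => x _; rewrite addrK.
Qed.

(* By translation invariance, the exchange already holds at the level of
   difference quotients, at the price of reversing the step; letting the step
   tend to 0 needs neither Fubini nor the symmetry of second derivatives. *)
Lemma integral_derive_exchange f g v w :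
  C1_along v f -> C1_along w f -> C1_along v g -> C1_along w g ->
  (\int[mu]_x ('D_v f x * 'D_w g x)%:E = \int[mu]_x ('D_w f x * 'D_v g x)%:E)%E.
Proof.
move=> fv fw gv gw; have [cf _ _] := fv; have [cg _ _] := gv.
pose u (k : nat) : R := k.+1%:R^-1.
have u0 k : u k != 0 by rewrite invr_eq0 pnatr_eq0.
have u1 k : `|u k| <= 1.
  by rewrite ger0_norm ?invr_ge0// invf_le1// ler1n.
have cu : u @ \oo --> 0 by exact: cvg_harmonic.
have L := integral_dquot_cvg fv gw u0 u1 cu.
have N0 k : - u k != 0 by rewrite oppr_eq0.
have N1 k : `|- u k| <= 1 by rewrite normrN.
have cN : - u k @[k --> \oo] --> 0 by rewrite -[X in _ --> X]oppr0; exact: cvgN.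
have L' := integral_dquot_cvg fw gv N0 N1 cN.
apply: (cvg_unique (@ereal_hausdorff R) L).
have E : (fun k => \int[mu]_x (dquot (u k) v f x * dquot (u k) w g x)%:E)%E =
    (fun k => \int[mu]_x (dquot (- u k) w f x * dquot (- u k) v g x)%:E)%E.
  by apply/funext => k; exact: integral_dquot_exchange.
by rewrite E.
Qed.

End null_lagrangian.

(** * Square integrable matrix fields and the pointwise criterion *)

Section square_integrable_matrix.
Context (R : realType) (n : nat) (U : set 'rV[R]_n) (mU : measurable U).
Local Notation mu := (lebesgue_rV R n).
Local Notation sqint := (@square_integrable R n U).
Implicit Types (f g : 'rV[R]_n -> R).

Lemma square_integrableM f g : sqint f -> sqint g ->
  mu.-integrable U (fun x => (f x * g x)%:E).
Proof.
have sq h : sqint h -> mu.-integrable U (fun x => (h x ^+ 2)%:E).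
  case=> mh hoo; apply/integrableP; split.
    exact/measurable_EFinP/measurable_funX.
  by under eq_integral do rewrite gee0_abs ?lee_fin ?sqr_ge0//.
move=> sf sg; apply: (le_integrable mU _ _ (integrableD mU (sq _ sf) (sq _ sg))).
  apply/measurable_EFinP; case: sf sg => mf _ [mg _].
  exact: measurable_funM.
move=> x _; rewrite /= lee_fin normrM [leRHS]ger0_norm ?addr_ge0 ?sqr_ge0//.
rewrite -(real_normK (num_real (f x))) -(real_normK (num_real (g x))).
have := sqr_ge0 (`|f x| - `|g x|).
have := mulr_ge0 (normr_ge0 (f x)) (normr_ge0 (g x)).
by nra.
Qed.

Lemma square_integrable0 : sqint (fun=> 0).
Proof.
split; first exact: measurable_cst.
by under eq_integral do rewrite expr0n; rewrite integral0.
Qed.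

Lemma square_integrableZ f (a : R) : sqint f -> sqint (fun x => a * f x).
Proof.
move=> sf; split; first by apply: measurable_funM => //; case: sf.
under eq_integral do rewrite exprMn EFinM.
rewrite (integralZl mU); last exact: (square_integrableM sf sf).
by apply: lte_mul_pinfty; [rewrite lee_fin sqr_ge0| |case: sf].
Qed.

Lemma square_integrableD f g : sqint f -> sqint g -> sqint (fun x => f x + g x).
Proof.
move=> sf sg; split; first by apply: measurable_funD; [case: sf|case: sg].
have fg := square_integrableM sf sg.
have ff := square_integrableM sf sf; have gg := square_integrableM sg sg.
have := integrableD mU (integrableD mU ff gg) (integrableD mU fg fg).
move=> /(integrable_lty mU); apply: le_lt_trans; rewrite le_eqVlt.
by apply/orP; left; apply/eqP/eq_integral => x _ /=; congr (_%:E); ring.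
Qed.

Lemma square_integrable_sum (I : finType) (F : I -> 'rV[R]_n -> R) :
  (forall i, sqint (F i)) -> sqint (fun x => \sum_i F i x).
Proof.
move=> sF; rewrite -[X in sqint X]/(fun x => \sum_i F i x).
have -> : (fun x => \sum_i F i x) = \sum_i F i by apply/funext => x; rewrite fct_sumE.
elim/big_ind : _ => //; first exact: square_integrable0.
exact: square_integrableD.
Qed.

Definition square_integrable_mx m p (G : 'rV[R]_n -> 'M[R]_(m, p)) :=
  forall i j, sqint (fun x => G x i j).

Lemma square_integrable_linear m p m' p'
    (L : {linear 'M[R]_(m, p) -> 'M[R]_(m', p')})
    (G : 'rV[R]_n -> 'M[R]_(m, p)) :
  square_integrable_mx G -> square_integrable_mx (fun x => L (G x)).
Proof.
move=> sG i j.
have -> : (fun x => L (G x) i j) =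
    (fun x => \sum_k \sum_l L (delta_mx k l) i j * G x k l).
  apply/funext => x; rewrite [in LHS](matrix_sum_delta (G x)) linear_sum summxE.
  apply: eq_bigr => k _; rewrite linear_sum summxE; apply: eq_bigr => l _.
  by rewrite linearZ mxE mulrC.
by do 2 apply: square_integrable_sum => ?; apply: square_integrableZ.
Qed.

Lemma square_integrable_mxB m p (G H : 'rV[R]_n -> 'M[R]_(m, p)) :
  square_integrable_mx G -> square_integrable_mx H ->
  square_integrable_mx (fun x => G x - H x).
Proof.
move=> sG sH i j.
have -> : (fun x => (G x - H x) i j) = (fun x => G x i j + (-1) * H x i j).
  by apply/funext => x; rewrite !mxE mulN1r.
by apply: square_integrableD => //; exact: square_integrableZ.
Qed.

Lemma integrable_sumr (I : finType) (F : I -> 'rV[R]_n -> R) :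
  (forall i, mu.-integrable U (EFin \o F i)) ->
  mu.-integrable U (fun x => (\sum_i F i x)%:E).
Proof.
move=> iF; under [X in _.-integrable _ X]eq_fun do rewrite -sumEFin.
by apply: (integrable_sum mU) => i _; exact: iF.
Qed.

Lemma integrable_mxdot m p (G H : 'rV[R]_n -> 'M[R]_(m, p)) :
  square_integrable_mx G -> square_integrable_mx H ->
  mu.-integrable U (fun x => (mxdot (G x) (H x))%:E).
Proof.
move=> sG sH; under [X in _.-integrable _ X]eq_fun do rewrite mxdotE.
by do 2 apply: integrable_sumr => ?; exact: square_integrableM.
Qed.

End square_integrable_matrix.

(** * From pointwise bounds to the Korn inequality *)

Section korn_criterion.
Context (R : realType) (n : nat).
Local Notation mu := (lebesgue_rV R n).
Implicit Types (f g : 'rV[R]_n -> R) (U : set 'rV[R]_n).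

Lemma test_function_C1 U f (i : 'I_n) :
  test_function U f -> C1_along (delta_mx ord0 i) f.
Proof.
case=> smf cf _; split; [split| |].
- by have [] := smf [::].
- have [r [_ fr]] := compact_bounded cf; exists (r + 1) => x rx.
  apply/eqP; apply: contraTT rx => fx; rewrite -leNgt.
  by apply: fr; [rewrite ltrDl|exact: subset_closure].
- by move=> x; have [_] := smf [::]; exact.
- by have [] := smf [:: i].
Qed.

Lemma test_function_partial_out U f (i : 'I_n) x :
  test_function U f -> ~ U x -> partial i f x = 0.
Proof.
case=> _ _ fU Ux; apply: derive_near0.
have oC : open (~` closure [set y | f y != 0]).
  by apply: closed_openC; exact: closed_closure.
have Cx : (~` closure [set y | f y != 0]) x by move=> /fU.
have := open_nbhs_nbhs (conj oC Cx); apply: filterS => y Cy.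
by apply/eqP; apply: contrapT => /negP fy; apply: Cy; exact: subset_closure.
Qed.

Lemma cbs_square_integrable U f : measurable U ->
  continuous_bounded_support f -> square_integrable U f.
Proof.
move=> mU cf; have [cof _] := cf; split.
  by apply: measurable_funTS; exact: continuous_measurable_rV.
have /integrableS : mu.-integrable setT (EFin \o (fun x => f x * f x)).
  by apply: cbs_integrable; exact: cbsM.
by move=> /(_ U measurableT mU (@subsetT _ _))/(integrable_lty mU).
Qed.

(** [Rintegral] is additive on integrable functions, so integrability is carried along with the
    value 0 through the sums of minors. *)
Definition null_integral F :=
  mu.-integrable setT (EFin \o F) /\ \int[mu]_x F x = 0.

Lemma null_integralZ (a : R) F : null_integral F -> null_integral (fun x => a * F x).
Proof.
case=> iF F0; split; last by rewrite RintegralZl// F0 mulr0.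
exact: (integrableZl measurableT a iF).
Qed.

Lemma null_integral_sum (I : finType) (F : I -> 'rV[R]_n -> R) :
  (forall i, null_integral (F i)) -> null_integral (fun x => \sum_i F i x).
Proof.
move=> nF; have -> : (fun x => \sum_i F i x) = \sum_i F i.
  by apply/funext => x; rewrite fct_sumE.
elim/big_ind : _ => // [|f g [fi f0] [gi g0]].
  split; last by rewrite Rintegral_cst// mul0r.
  exact: integrable0.
split; first exact: (integrableD measurableT fi gi).
by rewrite RintegralD// f0 g0 addr0.
Qed.

(* For A = grad phi, each 2 x 2 minor on the right integrates to 0. *)
Lemma trace_null_lagrangian m (A C : 'M[R]_m) :
  \tr (A *m C *m (A *m C)) - \tr (A *m C) ^+ 2 =
  \sum_i \sum_j \sum_k \sum_l C k j * C l i * (A i k * A j l - A i l * A j k).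
Proof.
have -> : \tr (A *m C *m (A *m C)) =
    \sum_i \sum_j \sum_k \sum_l C k j * C l i * (A i k * A j l).
  apply: eq_bigr => i _; rewrite mxE; apply: eq_bigr => j _.
  rewrite !mxE big_distrlr /=; apply: eq_bigr => k _; apply: eq_bigr => l _.
  by ring.
have -> : \tr (A *m C) ^+ 2 =
    \sum_i \sum_j \sum_k \sum_l C k j * C l i * (A i l * A j k).
  rewrite expr2 big_distrlr /=; apply: eq_bigr => i _; apply: eq_bigr => j _.
  rewrite !mxE big_distrlr /= exchange_big /=.
  by apply: eq_bigr => k _; apply: eq_bigr => l _; ring.
rewrite -sumrB; apply: eq_bigr => i _; rewrite -sumrB; apply: eq_bigr => j _.
rewrite -sumrB; apply: eq_bigr => k _; rewrite -sumrB; apply: eq_bigr => l _.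
by rewrite -mulrBr.
Qed.

Lemma null_integral_partial f g (i j : 'I_n) :
  (forall k, C1_along (delta_mx ord0 k) f) ->
  (forall k, C1_along (delta_mx ord0 k) g) ->
  null_integral (fun x =>
    partial i f x * partial j g x - partial j f x * partial i g x).
Proof.
move=> fC gC; have int (k l : 'I_n) :
    mu.-integrable setT (EFin \o (fun x => partial k f x * partial l g x)).
  by apply: cbs_integrable; apply: cbsM; exact: cbs_derive.
split; first exact: (integrableB measurableT (int i j) (int j i)).
rewrite (RintegralB measurableT (int i j) (int j i)).
rewrite /Rintegral (integral_derive_exchange (fC i) (fC j) (gC i) (gC j)).
exact: subrr.
Qed.

Lemma mxtrace_mul_mxdot m (A B : 'M[R]_m) : \tr (A *m B) = mxdot A^T B.
Proof. by rewrite /mxdot trmxK. Qed.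

Lemma integrable_trace U (G : 'rV[R]_n -> 'M[R]_n) (C : 'M[R]_n) :
  measurable U -> square_integrable_mx U G ->
  mu.-integrable U (fun x => (\tr (G x *m C *m (G x *m C)))%:E).
Proof.
move=> mU sG; under [X in _.-integrable _ X]eq_fun do rewrite mxtrace_mul_mxdot.
apply: integrable_mxdot => //.
  exact: (square_integrable_linear mU (trmx \o mulmxr C) sG).
exact: (square_integrable_linear mU (mulmxr C) sG).
Qed.

Lemma test_function_grad U V (phi : 'rV[R]_n -> 'rV[R]_n) : measurable V ->
  (forall i, test_function U (fun x => phi x ord0 i)) ->
  square_integrable_mx V (grad phi).
Proof.
move=> mV tphi i j; under eq_fun do rewrite mxE.
apply: cbs_square_integrable => //; apply: cbs_derive.
exact: test_function_C1 (tphi i).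
Qed.

Lemma integral_trace_grad_ge0 U (phi : 'rV[R]_n -> 'rV[R]_n) (C : 'M[R]_n) :
  (forall i, test_function U (fun x => phi x ord0 i)) ->
  0 <= \int[mu]_(x in U) \tr (grad phi x *m C *m (grad phi x *m C)).
Proof.
move=> tphi; rewrite Rintegral_mkcond.
pose q x := \tr (grad phi x *m C *m (grad phi x *m C)).
pose h x := q x - \tr (grad phi x *m C) ^+ 2.
have [ih h0] : null_integral h.
  rewrite /h /q; under eq_fun do rewrite trace_null_lagrangian.
  do 4 (apply: null_integral_sum => ?); apply: null_integralZ.
  under eq_fun do rewrite !mxE.
  by apply: null_integral_partial => k; exact: test_function_C1 (tphi _).
(* The gradient vanishes outside U, so the integral over U is one over R^n, where the null
   Lagrangian integrates to 0. *)
rewrite (_ : _ \_ U = q); last first.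
  apply/funext => x; rewrite patchE; case: ifPn => // xU.
  have G0 : grad phi x = 0.
    apply/matrixP => i j; rewrite !mxE; apply: (test_function_partial_out _ (tphi i)).
    by move/negP : xU; rewrite in_setE.
  by rewrite /q G0 !mul0mx mxtrace0.
rewrite -h0; apply: le_Rintegral => // [|x _]; last by rewrite /h gerBl sqr_ge0.
by apply: integrable_trace => //; exact: test_function_grad tphi.
Qed.

(* With X = G C and X - Y = (grad phi) C, this bounds the nonnegative integral of
   the approximants by the one for G up to arbitrarily small terms. *)
Lemma trace_young m (X Y : 'M[R]_m) (d : R) : 0 < d ->
  \tr ((X - Y) *m (X - Y)) <=
  \tr (X *m X) + d * mxdot X X + (1 + d^-1) * mxdot Y Y.
Proof.
(* This difference is |Y^T - Y|^2 / 2; it yields tr(Y^2) <= |Y|^2. *)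
move=> d0; have yy : 0 <= mxdot Y Y - mxdot Y^T Y.
  rewrite -(pmulr_rge0 _ (ltr0n R 2)); apply: le_trans (mxdot_ge0 (Y^T - Y)) _.
  rewrite -scaleN1r !(mxdotDl, mxdotDr, mxdotZl, mxdotZr) mxdot_tr [mxdot Y Y^T]mxdotC.
  by rewrite le_eqVlt; apply/orP; left; apply/eqP; ring.
(* Multiplied by d, this is |d X^T + Y|^2. *)
have xy : 0 <= d * mxdot X X + 2 * mxdot X^T Y + d^-1 * mxdot Y Y.
  rewrite -(pmulr_rge0 _ d0) !mulrDr [d * (d^-1 * _)]mulrA divff ?gt_eqF// mul1r.
  apply: le_trans (mxdot_ge0 (d *: X^T + Y)) _.
  rewrite !(mxdotDl, mxdotDr, mxdotZl, mxdotZr) mxdot_tr [mxdot Y X^T]mxdotC.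
  by rewrite le_eqVlt; apply/orP; left; apply/eqP; ring.
rewrite mulmxBr !mulmxBl !linearB /= [\tr (Y *m X)]mxtrace_mulC !mxtrace_mul_mxdot.
lra.
Qed.

Lemma zero_trace_integral_trace_ge0 U (z : 'rV[R]_n -> 'rV[R]_n)
    (G : 'rV[R]_n -> 'M[R]_n) (C : 'M[R]_n) : open U ->
  (forall i, square_integrable U (fun x => z x ord0 i)) ->
  square_integrable_mx U G -> zero_trace U z G ->
  0 <= \int[mu]_(x in U) \tr (G x *m C *m (G x *m C)).
Proof.
move=> oU sz sG tr0; have mU := open_measurable_rV oU.
have sGC := square_integrable_linear mU (mulmxr C) sG.
set I := \int[mu]_(x in U) _.
pose P := \int[mu]_(x in U) mxdot (G x *m C) (G x *m C).
have P0 : 0 <= P by apply: Rintegral_ge0 => x _; exact: mxdot_ge0.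
have iP := integrable_mxdot mU sGC sGC.
have iI := integrable_trace C mU sG.
(* If I < 0, the choice d = - I / (2 (P + 1)) would give 0 <= I / 2. The summand 1 keeps the
   denominator positive and leaves room d for the approximation error. *)
suff H d : 0 < d -> 0 <= I + d * (P + 1).
  rewrite leNgt; apply/negP => I0.
  have P1 : 0 < P + 1 by rewrite ltr_wpDl.
  have := H (- I / (2 * (P + 1))).
  rewrite divr_gt0 ?oppr_gt0 ?mulr_gt0// => /(_ isT).
  rewrite invfM mulrA mulfVK ?gt_eqF//; lra.
move=> d0.
have c0 : 0 < 1 + d^-1 by rewrite ltr_wpDl// invr_gt0.
have C1 : 0 < mxdot C C + 1 by rewrite ltr_wpDl// mxdot_ge0.
(* Chosen so that (1 + 1/d) |C|^2 e <= d, the room left above; |C|^2 + 1 avoids a division by 0 when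
   C = 0. *)
pose e := d / ((1 + d^-1) * (mxdot C C + 1)).
have e0 : 0 < e by rewrite divr_gt0// mulr_gt0.
have [phi [tphi phie]] := tr0 e e0.
have sphi := test_function_grad mU tphi.
pose D x := G x - grad phi x.
have sD : square_integrable_mx U D by exact: square_integrable_mxB.
have sDC := square_integrable_linear mU (mulmxr C) sD.
have iD := integrable_mxdot mU sD sD.
have iDC := integrable_mxdot mU sDC sDC.
have De : \int[mu]_(x in U) mxdot (D x) (D x) <= e.
  rewrite -lee_fin fineK ?(integrable_fin_num mU)//.
  apply: le_trans (ltW phie); rewrite /W12_sqnorm.
  under [leRHS]eq_integral do rewrite !sqr_frob.
  have szphi : square_integrable_mx U (fun x => z x - phi x).
    apply: square_integrable_mxB => // i j; rewrite ord1//.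
    apply: cbs_square_integrable => //.
    by have [] := test_function_C1 j (tphi j).
  have izphi := integrable_mxdot mU szphi szphi.
  apply: le_integral => //; first exact: (integrableD mU izphi iD).
  by move=> x _; rewrite lee_fin lerDr mxdot_ge0.
have DCe : \int[mu]_(x in U) mxdot (D x *m C) (D x *m C) <= mxdot C C * e.
  apply: (@le_trans _ _ (\int[mu]_(x in U) (mxdot C C * mxdot (D x) (D x)))).
    apply: le_Rintegral => //; first exact: (integrableZl mU (mxdot C C) iD).
    by move=> x _; rewrite mulrC; exact: mxdot_mulmx.
  by rewrite RintegralZl// ler_wpM2l// mxdot_ge0.
apply: le_trans (integral_trace_grad_ge0 C tphi) _.
apply: (@le_trans _ _ (\int[mu]_(x in U) (\tr (G x *m C *m (G x *m C)) +
   d * mxdot (G x *m C) (G x *m C) + (1 + d^-1) * mxdot (D x *m C) (D x *m C)))).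
  apply: le_Rintegral => //.
  - exact: integrable_trace.
  - exact: (integrableD mU (integrableD mU iI (integrableZl mU d iP))
      (integrableZl mU (1 + d^-1) iDC)).
  - move=> x _; rewrite -[grad phi x in leLHS](subKr (G x)) -/(D x) mulmxBl.
    exact: trace_young.
rewrite RintegralD//; last 2 first.
- exact: (integrableD mU iI (integrableZl mU d iP)).
- exact: (integrableZl mU (1 + d^-1) iDC).
rewrite RintegralD//; last exact: (integrableZl mU d iP).
rewrite !RintegralZl// -/P -/I -addrA lerD2l mulrDr mulr1 lerD2l.
apply: (@le_trans _ _ ((1 + d^-1) * (mxdot C C * e))).
  by rewrite ler_wpM2l// ltW.
apply: (@le_trans _ _ ((1 + d^-1) * ((mxdot C C + 1) * e))).
  by rewrite ler_wpM2l ?ler_wpM2r ?lerDl// ltW.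
by rewrite mulrA /e mulrC mulfVK// mulf_neq0// gt_eqF.
Qed.

(** Linearity of M makes M G square integrable, so both sides are finite and can be compared as real
    integrals. *)
Lemma korn_of_pointwise (M : {linear 'M[R]_n -> 'M[R]_n})
    (gamma c : R) (C : 'M[R]_n) :
  0 <= c ->
  (forall A, mxdot A A + c * \tr (A *m C *m (A *m C)) <= gamma * mxdot (M A) A) ->
  korn_inequality M gamma.
Proof.
move=> c0 MA U oU _ z G [sz sG _] tr0; have mU := open_measurable_rV oU.
have iG := integrable_mxdot mU sG sG.
have sMG := square_integrable_linear mU M sG.
have iM := integrable_mxdot mU sMG sG.
have iq := integrable_trace C mU sG.
have q0 := zero_trace_integral_trace_ge0 C oU sz sG tr0.
under eq_integral do rewrite sqr_frob.
rewrite -(fineK (integrable_fin_num mU iG)) -(fineK (integrable_fin_num mU iM)).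
rewrite -EFinM lee_fin -!/(Rintegral _ _ _).
apply: (@le_trans _ _ (\int[mu]_(x in U) mxdot (G x) (G x) +
   c * \int[mu]_(x in U) \tr (G x *m C *m (G x *m C)))).
  by rewrite lerDl mulr_ge0.
rewrite -!RintegralZl// -RintegralD//; last exact: (integrableZl mU c iq).
apply: le_Rintegral => //; first exact: (integrableD mU iG (integrableZl mU c iq)).
exact: (integrableZl mU gamma iM).
Qed.

End korn_criterion.

(** * The viscous stress tensors *)

Section stress_differentials.
Context (R : realType) (n : nat).
Implicit Types A F Q : 'M[R]_n.

Lemma sym_is_linear : linear (@sym R n).
Proof.
move=> a A B; rewrite /sym (_ : (a *: A + B)^T = a *: A^T + B^T) ?linearP//.
rewrite addrACA.
by rewrite !scalerDr !scalerA [_ * a]mulrC.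
Qed.

HB.instance Definition _ :=
  GRing.isLinear.Build R 'M[R]_n 'M[R]_n *:%R (@sym R n) sym_is_linear.

Lemma D2_is_diff (Z : 'M[R]_n -> 'M[R]_n -> 'M[R]_n) F Q (L : 'M[R]_n -> 'M[R]_n) A :
  is_diff Q (Z F) L -> D2 Z F Q A = L A.
Proof. by move=> dZ; rewrite /D2 diff_val. Qed.

(** The tensor is linear in Q, hence equal to its own derivative at every Q. *)
Lemma D2_stress0'' F Q A : D2 (@stress0'' R n) F Q A = stress0'' F A.
Proof.
apply: D2_is_diff; exact: (@is_diff_linear_mx R n n _
  ( *:%R 2 \o (mulmx F \o (@sym R n \o mulmx F^T))) Q).
Qed.

Lemma D2_stress0' F Q A : D2 (@stress0' R n) F Q A = stress0' F A.
Proof.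
apply: D2_is_diff; exact: (@is_diff_linear_mx R n n _
  ( *:%R (2 * \det F) \o (mulmxr (invmx F)^T \o (@sym R n \o mulmxr (invmx F)))) Q).
Qed.

Lemma is_diff_sym_mulmx F Q :
  is_diff Q (fun Q => sym (Q *m invmx F)) (fun A => sym (A *m invmx F)).
Proof. exact: (@is_diff_linear_mx R n n _ (@sym R n \o mulmxr (invmx F)) Q). Qed.

Lemma is_diff_mulmxr (f df : 'M[R]_n -> 'M[R]_n) Q (B : 'M[R]_n) :
  is_diff Q f df -> is_diff Q (fun Q => f Q *m B) (fun A => df A *m B).
Proof.
move=> dfQ; apply: (is_diff_eq (is_diff_mulmx dfQ (is_diff_cst B Q))).
by apply/funext => A /=; rewrite (_ : (0 : 'M[R]_n -> 'M[R]_n) A = 0)// mulmx0 addr0.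
Qed.

Lemma D2_stress_0 F Q A :
  D2 (@stress R n 0) F Q A = sym (A *m invmx F) *m (invmx F)^T.
Proof.
apply: (@D2_is_diff _ _ _ (fun A => sym (A *m invmx F) *m (invmx F)^T)).
rewrite (_ : stress 0 F =
    fun Q => sym (Q *m invmx F) *m (invmx F)^T); last first.
  by apply/funext => X; rewrite /stress expr1.
exact/is_diff_mulmxr/is_diff_sym_mulmx.
Qed.

(** The shape of the result is what the product rule yields for the bracketing T (T T), and
    [mxdot_pow3] is stated in this shape; likewise [mxdot_pow5] for (T T) (T (T T)). *)
Lemma D2_stress_1 F Q A (S := sym (Q *m invmx F)) (E := sym (A *m invmx F)) :
  D2 (@stress R n 1) F Q A =
  (E *m (S *m S) + S *m (E *m S + S *m E)) *m (invmx F)^T.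
Proof.
apply: (@D2_is_diff _ _ _ (fun A => let E := sym (A *m invmx F) in
  (E *m (S *m S) + S *m (E *m S + S *m E)) *m (invmx F)^T)).
rewrite (_ : stress 1 F = fun Q =>
    (fun Q => let T := sym (Q *m invmx F) in T *m (T *m T)) Q *m (invmx F)^T).
  apply: is_diff_mulmxr; have dS := is_diff_sym_mulmx F Q.
  exact: (is_diff_mulmx dS (is_diff_mulmx dS dS)).
by apply/funext => X; rewrite /stress !exprS expr0 mulr1.
Qed.

Lemma D2_stress_2 F Q A (S := sym (Q *m invmx F)) (E := sym (A *m invmx F)) :
  D2 (@stress R n 2) F Q A =
  ((E *m S + S *m E) *m (S *m (S *m S)) +
    (S *m S) *m (E *m (S *m S) + S *m (E *m S + S *m E))) *m (invmx F)^T.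
Proof.
apply: (@D2_is_diff _ _ _ (fun A => let E := sym (A *m invmx F) in
  ((E *m S + S *m E) *m (S *m (S *m S)) +
    (S *m S) *m (E *m (S *m S) + S *m (E *m S + S *m E))) *m (invmx F)^T)).
rewrite (_ : stress 2 F = fun Q =>
    (fun Q => let T := sym (Q *m invmx F) in T *m T *m (T *m (T *m T))) Q
    *m (invmx F)^T).
  apply: is_diff_mulmxr; have dS := is_diff_sym_mulmx F Q.
  have dS2 := is_diff_mulmx dS dS.
  exact: (is_diff_mulmx dS2 (is_diff_mulmx dS dS2)).
by apply/funext => X; rewrite /stress -[(2 * 2 + 1)%N]/(2 + 3)%N exprD !exprS expr0 mulr1.
Qed.

End stress_differentials.

(** With c = |F|^2 and C = F^-1 the trace terms on both sides cancel, leaving |A|^2 <= |F|^2 |A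
    F^-1|^2. *)
Lemma korn_of_sym (R : realType) n (F : 'M[R]_n) (M : {linear 'M[R]_n -> 'M[R]_n})
    (gamma : R) : F \in unitmx ->
  (forall A, 2 * frob F ^+ 2 *
      mxdot (sym (A *m invmx F)) (sym (A *m invmx F)) <= gamma * mxdot (M A) A) ->
  korn_inequality M gamma.
Proof.
move=> Fu MA.
apply: (@korn_of_pointwise _ _ _ _ (frob F ^+ 2) (invmx F)); first exact: sqr_ge0.
move=> A; apply: le_trans (MA A).
rewrite sqr_frob [2 * _]mulrC -[leRHS]mulrA mxdot_sym mulrDr lerD2r mulrC.
exact: mxdot_le_unitr.
Qed.

Theorem lemma2p3 (R : realType) (n : nat) (F0 Q0 : 'M[R]_n)
    (detF0 : 0 < \det F0) :
  [/\ korn_inequality (D2 (@stress0'' R n) F0 Q0) (frob (invmx F0)^T ^+ 2),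
      korn_inequality (D2 (@stress0' R n) F0 Q0)
        (frob F0 ^+ 2 * (\det F0)^-1),
      korn_inequality (D2 (@stress R n 0) F0 Q0) (2 * frob F0 ^+ 2) &
      \det (sym (Q0 *m invmx F0)) != 0 ->
        korn_inequality (D2 (@stress R n 1) F0 Q0)
          (2 * frob F0 ^+ 2 * frob (invmx (sym (Q0 *m invmx F0))) ^+ 2) /\
        korn_inequality (D2 (@stress R n 2) F0 Q0)
          (2 * frob F0 ^+ 2 * frob (invmx (sym (Q0 *m invmx F0))) ^+ 4)].
Proof.
have Fu : F0 \in unitmx by rewrite unitmxE unitfE gt_eqF.
split.
- apply: (@korn_of_pointwise _ _ _ _ (frob (invmx F0)^T ^+ 2) F0^T).
    exact: sqr_ge0.
  move=> A; rewrite [X in _ <= _ * mxdot X _]D2_stress0'' /stress0'' mxdotZl.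
  rewrite mxdot_mulmxl -[mxdot _ (F0^T *m A)]mxdot_symr ?trmx_sym//.
  rewrite mxdot_sym sqr_frob mulrDr.
  (* The tensor involves F0^T A, the criterion A F0^T; by cyclicity their squares have the same
     trace. *)
  rewrite -[A *m F0^T *m _]mulmxA mxtrace_mulC !mulmxA lerD2r.
  by rewrite trmx_inv mxdot_le_unitl ?unitmx_tr.
- apply: (korn_of_sym Fu) => A.
  rewrite [X in _ <= _ * mxdot X _]D2_stress0' /stress0'.
  rewrite [X in _ <= _ * X]mxdotZl mxdot_mulmxr.
  rewrite -[mxdot _ (A *m _)]mxdot_symr ?trmx_sym//.
  (* Equality holds: the factor 2 det F0 of the tensor cancels the inverse determinant in gamma and
     supplies the 2. *)
  by rewrite le_eqVlt; apply/orP; left; apply/eqP; field; rewrite gt_eqF.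
- apply: (korn_of_sym Fu) => A.
  rewrite [X in _ <= _ * mxdot X _]D2_stress_0 mxdot_mulmxr.
  by rewrite -[mxdot _ (A *m _)]mxdot_symr ?trmx_sym.
move=> detS.
have Su : sym (Q0 *m invmx F0) \in unitmx by rewrite unitmxE unitfE.
have F2 : 0 <= 2 * frob F0 ^+ 2 by rewrite mulr_ge0// sqr_ge0.
split; apply: (korn_of_sym Fu) => A; rewrite -[leRHS]mulrA ler_wpM2l//.
- rewrite [X in _ <= _ * mxdot X _]D2_stress_1 mxdot_mulmxr sqr_frob.
  apply: le_trans (mxdot_pow3_ge (trmx_sym _) (trmx_sym _) Su) _.
  by rewrite mxdot_symr// trmx_pow3 ?trmx_sym.
- rewrite [X in _ <= _ * mxdot X _]D2_stress_2 mxdot_mulmxr.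
  rewrite (exprM _ 2 2) sqr_frob.
  apply: le_trans (mxdot_pow5_ge (trmx_sym _) (trmx_sym _) Su) _.
  by rewrite mxdot_symr// trmx_pow5 ?trmx_sym.
Qed.
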